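(* Let $\Gamma$ be an infinite, finitely generated, elementary amenable group. Then any locally finite Cayley graph $G$ of $\Gamma$ admits a harmonic, strong graph height function; that is, there exists a strong graph height function $(h,\mathcal H)$ of the pair $(\Gamma,G)$ such that $h$ is harmonic on $G$.
   Context: Elementary amenable groups: the class $\mathrm{EG}$ of elementary amenable groups is the smallest class of groups that contains all finite groups and all abelian groups and is closed under the operations of taking subgroups, and of forming quotients, extensions, and directed unions. Cayley graphs: let $\Gamma$ be a group with identity $\mathbf 1$ and a finite generating set $S$ with $S^{-1}=S$ and $\mathbf 1\notin S$. The (locally finite) Cayley graph $G=G(\Gamma,S)$ is the simple graph with vertex-set $V=\Gamma$ and an undirected edge $\langle\gamma_1,\gamma_2\rangle$ if and only if $\gamma_2=\gamma_1 s$ for some $s\in S$. The group $\Gamma$ acts on $G$ by left multiplication. Graph height functions: let $G=(V,E)$ be an infinite, locally finite, connected, vertex-transitive simple graph with a distinguished vertex $\mathbf 1$ (the identity in the case of a Cayley graph), and let $\partial v$ denote the set of neighbours of $v$. For $\mathcal H\le\mathrm{Aut}(G)$, a function $F:V\to\mathbb R$ is $\mathcal H$-difference-invariant if $F(v)-F(w)=F(\gamma v)-F(\gamma w)$ for all $v,w\in V$ and $\gamma\in\mathcal H$. A subgroup of $\mathrm{Aut}(G)$ acts quasi-transitively if it has finitely many orbits on $V$. A graph height function on $G$ is a pair $(h,\mathcal H)$ where $\mathcal H\le\mathrm{Aut}(G)$ acts quasi-transitively on $G$ and $h:V\to\mathbb Z$ satisfies: (a) $h(\mathbf 1)=0$;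 (b) $h$ is $\mathcal H$-difference-invariant; (c) for every $v\in V$ there exist $u,w\in\partial v$ with $h(u)<h(v)<h(w)$. Strong graph height functions: for a Cayley graph $G$ of a finitely generated group $\Gamma$, a pair $(h,\mathcal H)$ is a strong graph height function of $(\Gamma,G)$ if $\mathcal H$ is a normal subgroup of $\Gamma$, acting on $\Gamma$ by left multiplication, with $[\Gamma:\mathcal H]<\infty$, and $(h,\mathcal H)$ is a graph height function on $G$. Harmonic: $h:V\to\mathbb R$ is harmonic on $G$ if $h(v)=\frac1{\deg(v)}\sum_{u\sim v}h(u)$ for all $v\in V$. *)

(* Defs.v *)
From HB Require Import structures.
From mathcomp Require Import all_boot all_order all_algebra.
From mathcomp Require Import finmap.
From mathcomp Require Import all_classical reals.

Set Implicit Arguments.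
Unset Strict Implicit.
Unset Printing Implicit Defensive.

Import Order.TTheory GRing.Theory Num.Theory.

Local Open Scope classical_set_scope.
Local Open Scope ring_scope.
Local Open Scope group_scope.

Section Subgroups.
Variable G : groupType.
Implicit Types A N : set G.

Definition subgroup N : Prop :=
  [/\ N 1, forall x y, N x -> N y -> N (x * y) & forall x, N x -> N x^-1].

Definition normal_subgroup N : Prop :=
  subgroup N /\ forall g x, N x -> N (g * x * g^-1).

Definition finite_index N : Prop :=
  finite_set [set [set g * x | x in N] | g in [set: G]].

Definition generates A : Prop :=
  forall N, subgroup N -> A `<=` N -> N = [set: G].

Definition finitely_generated : Prop :=
  exists A, finite_set A /\ generates A.

End Subgroups.

(* The least class closed under the operations, obtained as an inductive
   predicate. Subgroups and quotients are given, up to isomorphism, by injective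
   and surjective homomorphisms; in particular the class is closed under
   isomorphism. In EG_directed_union the subgroups are the ranges of the f i. *)
Inductive elementary_amenable : groupType -> Prop :=
| EG_finite (G : groupType) :
    finite_set [set: G] -> elementary_amenable G
| EG_abelian (G : groupType) :
    (forall x y : G, x * y = y * x) -> elementary_amenable G
| EG_subgroup (G H : groupType) (f : {multiplicative H -> G}) :
    injective f -> elementary_amenable G -> elementary_amenable H
| EG_quotient (G H : groupType) (f : {multiplicative G -> H}) :
    range f = [set: H] -> elementary_amenable G -> elementary_amenable H
| EG_extension (N G Q : groupType)
    (f : {multiplicative N -> G}) (p : {multiplicative G -> Q}) :
    injective f -> range p = [set: Q] -> range f = p @^-1` [set 1] ->
    elementary_amenable N -> elementary_amenable Q -> elementary_amenable G
| EG_directed_union (G : groupType) (I : Type) (K : I -> groupType)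
    (f : forall i, {multiplicative K i -> G}) :
    (forall i, injective (f i)) ->
    (forall i j, exists k,
      range (f i) `<=` range (f k) /\ range (f j) `<=` range (f k)) ->
    (forall x, exists i, range (f i) x) ->
    (forall i, elementary_amenable (K i)) -> elementary_amenable G.

(* A simple graph is given by its (symmetric, irreflexive) adjacency relation
   [adj] on the type of vertices. *)
Section Graphs.
Variables (V : choiceType) (adj : V -> V -> Prop).

Definition neighbours (v : V) : set V := [set u | adj v u].

Definition automorphism (a : V -> V) : Prop :=
  bijective a /\ forall u v, adj (a u) (a v) <-> adj u v.

Definition automorphism_subgroup (H : set (V -> V)) : Prop :=
  [/\ H `<=` [set a | automorphism a],
      H id,
      forall a b, H a -> H b -> H (a \o b)
    & forall a b, H a -> cancel a b -> cancel b a -> H b].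

Definition quasi_transitive (H : set (V -> V)) : Prop :=
  finite_set [set [set a v | a in H] | v in [set: V]].

Definition difference_invariant (M : zmodType) (H : set (V -> V))
    (F : V -> M) : Prop :=
  forall v w a, H a -> (F v - F w = F (a v) - F (a w))%R.

Definition graph_height_function (o : V) (h : V -> int) (H : set (V -> V)) :
    Prop :=
  [/\ automorphism_subgroup H,
      quasi_transitive H,
      h o = 0%R,
      difference_invariant H h
    & forall v, exists u w,
        [/\ neighbours v u, neighbours v w & (h u < h v < h w)%R]].

(* Meaningful for locally finite graphs only: [fset_set] and the sum over an
   infinite set of neighbours would be junk values. *)
Definition harmonic (R : realType) (F : V -> R) : Prop :=
  forall v,
    (F v = (#|` fset_set (neighbours v)|%:R)^-1 *
           \sum_(u \in neighbours v) F u)%R.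

End Graphs.

Section CayleyGraphs.
Variable G : groupType.
Implicit Types (S N : set G) (h : G -> int).

Definition cayley_generating_set S : Prop :=
  [/\ finite_set S, generates S, [set s^-1 | s in S] = S & ~ S 1].

Definition cayley_adj S (x y : G) : Prop := exists2 s, S s & y = x * s.

Lemma cayley_adj_sym S x y :
  cayley_generating_set S -> cayley_adj S x y -> cayley_adj S y x.
Proof.
move=> [_ _ SV _] [s Ss ->]; exists s^-1; last by rewrite mulgK.
by rewrite -SV; exists s.
Qed.

Lemma cayley_adj_irrefl S x : cayley_generating_set S -> ~ cayley_adj S x x.
Proof.
move=> [_ _ _ S1] [s Ss] /(congr1 (fun y => x^-1 * y)).
by rewrite mulVg mulKg => s1; apply: S1; rewrite s1.
Qed.

Definition left_translations N : set (G -> G) :=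
  [set (fun v => g * v) | g in N].

Definition strong_graph_height_function S h N : Prop :=
  [/\ normal_subgroup N, finite_index N
    & graph_height_function (cayley_adj S) 1 h (left_translations N)].

End CayleyGraphs.

(* Main.v *)
Require Import Defs.
From mathcomp Require Import all_boot all_order all_algebra.
From mathcomp Require Import finmap.
From mathcomp Require Import all_classical reals.

(** An infinite, finitely generated, elementary amenable group G has a normal
    subgroup N of finite index with a nonzero homomorphism [phi : N -> int];
    such a homomorphism extends to an integer-valued harmonic function with the
    required invariance, and a generic combination of translates of that
    function is nowhere locally constant.

    _Existence of phi._  By induction over the class of elementary amenable
    groups, every finitely generated section B/A of a member is finite or has a
    finite-index subgroup mapping nontrivially to the integers
    ([elementary_amenable_sections]).  Quantifying over all sections makes the
    closure under subgroups and quotients immediate, and a finitely generated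
    section of a directed union is already a section of one of its terms.  For
    an extension with kernel K and quotient Q there is C between A and B such
    that C/A is a section of K and B/C one of Q.  If B/C is infinite, the
    homomorphism it provides also serves for B/A.  If B/C is finite, then C/A is
    finitely generated by Schreier's lemma ([schreier]), so that the induction
    hypothesis applies to it, and finiteness of index is transitive.  Abelian
    groups are handled by the same dichotomy, splitting off one generator at a
    time.  Passing to the normal core makes the domain normal
    ([additive_on_finite_index_nonzero]).

    _Harmonic extension_ ([harmonic_extension]).  A function with
    [h (g * x) = phi g + h x] for g in N is determined by its values a_j on a
    transversal of N.  It is harmonic if and only if a solves [L a = b], where L
    is the Laplacian of the finite quotient graph and b is computed from phi.
    As the generating set is symmetric, L is symmetric and the entries of b add
    up to 0; as the quotient is connected, the kernel of L consists of the
    constants, by the maximum principle.  Hence b is orthogonal to the kernel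
    and the system has a rational solution; clearing denominators multiplies phi by
    a nonzero integer.

    _Strictly increasing and decreasing neighbours_
    ([nowhere_locally_constant_height]).  Some translate of h changes along a
    fixed generator s at any prescribed vertex, and by invariance only the
    finitely many vertices of a transversal matter.  So an integer combination
    of translates, with coefficients the powers of an integer avoiding the roots
    of finitely many nonzero polynomials, changes along s at every vertex.
    Harmonicity turns a nonzero change along one edge into an increase along one
    edge and a decrease along another. *)

Set Implicit Arguments.
Unset Strict Implicit.
Unset Printing Implicit Defensive.

Import Order.TTheory GRing.Theory Num.Theory.

Local Open Scope classical_set_scope.
Local Open Scope ring_scope.
Local Open Scope group_scope.

(** * Integer powers *)

Section IntegerPowers.
Variable G : groupType.
Implicit Types (x : G) (k l : int).

Definition expgz x k : G :=
  match k with Posz n => x ^+ n | Negz n => x ^- n.+1 end.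

Lemma expgz_succ x k : expgz x (k + 1)%R = expgz x k * x.
Proof.
case: k => [n|[|n]].
- by rewrite /= addn1 expgSr.
- by rewrite /= expg1 mulVg.
- have -> : (Negz n.+1 + 1)%R = Negz n by rewrite !NegzE -addn1 PoszD opprD addrNK.
  by rewrite /= [in RHS]expgS invgM mulgVK.
Qed.

Lemma expgzD x k l : expgz x (k + l)%R = expgz x k * expgz x l.
Proof.
elim: l => [|n IH|n IH].
- by rewrite addr0 mulg1.
- by rewrite -addn1 PoszD addrA !expgz_succ IH mulgA.
- apply: (mulIg x); rewrite -mulgA -!expgz_succ -addrA.
  by rewrite -addn1 PoszD opprD addrNK IH.
Qed.

Lemma expgzN x k : expgz x (- k)%R = (expgz x k)^-1.
Proof. by apply/esym/mulg1_eq; rewrite -expgzD subrr. Qed.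

End IntegerPowers.

(** * Finite index and virtual indicability inside a fixed group *)

Section Virtual.
Variable G : groupType.
Implicit Types (A B C D : set G) (X : seq G) (x y : G).

(** Finite generation of B/A, phrased without forming the quotient. *)
Definition generated_mod A X B :=
  forall D, subgroup D -> A `<=` D -> [set` X] `<=` D -> B `<=` D.

(** A finite list of representatives meeting every left coset of C in B,
    possibly with repetitions, is easier to build than an enumeration of the
    cosets. *)
Definition finite_index_in C B :=
  exists2 s : seq G, [set` s] `<=` B &
    forall x, B x -> exists2 t, t \in s & C (t^-1 * x).

(** Homomorphisms to the integers are total functions on G that are constrained
    on the subgroup D only, which avoids making D into a type. *)
Definition additive_on D (phi : G -> int) :=
  forall x y, D x -> D y -> phi (x * y) = (phi x + phi y)%R.

(** B/A has a subgroup of finite index, the image of D, with a nonzero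
    homomorphism to the integers: phi descends to D/(A `&` D), because it
    vanishes on A. *)
Definition virtually_indicable_mod A B :=
  exists D (phi : G -> int),
    [/\ subgroup D /\ D `<=` B, finite_index_in D B, additive_on D phi,
        forall a, A a -> D a -> phi a = 0%R
      & exists2 x, D x & phi x <> 0%R].

Definition normal_in A B :=
  [/\ subgroup A, A `<=` B & forall b a, B b -> A a -> A (b * a * b^-1)].

Lemma normal_inV A B b a : subgroup B -> normal_in A B ->
  B b -> A a -> A (b^-1 * a * b).
Proof.
move=> [_ _ BV] [_ _ nA] Bb Aa.
by have := nA b^-1 a (BV _ Bb) Aa; rewrite invgK.
Qed.

Lemma finite_index_in_trans B C D :
  subgroup B -> C `<=` B ->
  finite_index_in D C -> finite_index_in C B -> finite_index_in D B.
Proof.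
move=> [_ BM BV] CB [s sC sD] [r rB rC].
exists [seq t * u | t <- r, u <- s].
  move=> _ /allpairsP[[t u] /= [tr us ->]].
  by apply: BM; [exact: rB | exact/CB/sC].
move=> x Bx; have [t tr Cx] := rC x Bx; have [u us Du] := sD _ Cx.
exists (t * u); first by apply/allpairsP; exists (t, u).
by rewrite invgM -mulgA.
Qed.

Lemma finite_index_in_classes (T : finType) (p : G -> T) B C :
  (forall x y, B x -> B y -> p x = p y -> C (x^-1 * y)) ->
  finite_index_in C B.
Proof.
move=> pC; pose E i := [set x | B x /\ p x = i].
have /choice[t tP] : forall i, exists x, (exists y, E i y) -> E i x.
  move=> i; have [[x Ex]|no] := pselect (exists y, E i y); first by exists x.
  by exists 1 => /no.
exists [seq t i | i <- enum T & `[< exists y, E i y >]].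
  by move=> _ /mapP[i + ->]; rewrite mem_filter => /andP[/asboolP/tP[]].
move=> x Bx; have Ex : exists y, E (p x) y by exists x.
exists (t (p x)).
  by apply/map_f; rewrite mem_filter mem_enum andbT; apply/asboolP.
by have [Bt pt] := tP _ Ex; exact: pC.
Qed.

Lemma virtually_indicable_overgroup A B C :
  subgroup B -> C `<=` B -> finite_index_in C B ->
  virtually_indicable_mod A C -> virtually_indicable_mod A B.
Proof.
move=> sB CB iC [D [phi [[sD DC] iD aD zD nD]]].
exists D, phi; split => //; first by split=> // x /DC/CB.
exact: finite_index_in_trans iD iC.
Qed.

Lemma virtually_indicable_quotient A C B : A `<=` C ->
  virtually_indicable_mod C B -> virtually_indicable_mod A B.
Proof.
move=> AC [D [phi [sD iD aD zD nD]]]; exists D, phi; split => // a /AC.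
exact: zD.
Qed.

(** Schreier's lemma modulo A.  The generators of C are the elements of C among
    the products [t'^-1 * x * t] with t, t' coset representatives and x a
    generator or the inverse of one, together with the representatives that lie
    in C.  If D contains them and A, then the elements of B that move every
    representative t to some [t' * d] with d in D, as do their inverses, form a
    subgroup containing A and X, hence all of B; applied to an element of C,
    this puts it in D. *)
Lemma schreier A B C X :
  subgroup B -> subgroup C -> normal_in A B -> A `<=` C -> C `<=` B ->
  finite_index_in C B -> [set` X] `<=` B -> generated_mod A X B ->
  exists2 Y, [set` Y] `<=` C & generated_mod A Y C.
Proof.
move=> sB sC nA AC CB [s sBs sC'] XB gX.
have [B1 BM BV] := sB; have [C1 CM CV] := sC.
pose Z := s ++ [seq t.1^-1 * (x * t.2) | t <- [seq (t, u) | t <- s, u <- s],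
                  x <- X ++ [seq x^-1 | x <- X]].
exists [seq z <- Z | `[< C z >]].
  by move=> z /=; rewrite mem_filter => /andP[/asboolP].
move=> D' sD' AD' YD' c Cc.
(* Intersecting with C ensures that a coset representative t' reached from C
   lies in C, hence among the generators. *)
pose D := D' `&` C.
have [D1 DM DV] : subgroup D.
  case: sD' => D1 DM DV; split=> //.
  - by move=> x y [? ?] [? ?]; split; [exact: DM | exact: CM].
  - by move=> x [? ?]; split; [exact: DV | exact: CV].
have AD : A `<=` D by move=> a Aa; split; [exact: AD' | exact: AC].
have YD z : z \in Z -> C z -> D z.
  move=> Zz Cz; split=> //; apply: YD'; rewrite /= mem_filter Zz andbT.
  exact/asboolP.
pose step b := forall t, t \in s -> exists2 t', t' \in s & D (t'^-1 * (b * t)).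
pose E := [set b | [/\ B b, step b & step b^-1]].
have stepM b b' : step b -> step b' -> step (b * b').
  move=> hb hb' t ts; have [t' t's Dt'] := hb' t ts.
  have [t'' t''s Dt''] := hb t' t's; exists t'' => //.
  by have := DM _ _ Dt'' Dt'; rewrite !mulgA mulgK.
have stepA a : A a -> step a.
  move=> Aa t ts; exists t => //; apply: AD; rewrite mulgA.
  exact: (normal_inV sB nA (sBs _ ts) Aa).
have stepX x : x \in X ++ [seq x^-1 | x <- X] -> step x.
  move=> Xx t ts; have Bx : B x.
    move: Xx; rewrite mem_cat => /orP[/XB //|/mapP[y Xy ->]].
    by apply: BV; exact: XB.
  have [t' t's Ct'] := sC' (x * t) (BM _ _ Bx (sBs _ ts)).
  exists t' => //; apply: YD => //; rewrite mem_cat; apply/orP; right.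
  apply/allpairsP; exists ((t', t), x); split=> //=.
  by apply/allpairsP; exists (t', t).
have sE : subgroup E.
  split.
  - have h : step 1 by apply: stepA; case: nA => [[]].
    by split=> //; rewrite invg1.
  - move=> x y [Bx sx sx'] [By sy sy']; split; [exact: BM | exact: stepM |].
    by rewrite invgM; exact: stepM.
  - by move=> x [Bx sx sx']; split; rewrite ?invgK //; exact: BV.
have [Bc] : E c.
  apply: (gX E) => //; last exact: CB.
  - move=> a Aa; split; [exact/CB/AC | exact: stepA | apply: stepA].
    by case: nA => [[_ _ AV] _ _]; exact: AV.
  - move=> x Xx; split; [exact: XB | apply: stepX | apply: stepX].
      by rewrite mem_cat Xx.
    by rewrite mem_cat; apply/orP; right; apply/mapP; exists x.
(* The representative t0 of the coset C itself is the starting point. *)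
have [t0 t0s] := sC' 1 B1; rewrite mulg1 => /CV; rewrite invgK => Ct0.
move=> /(_ t0 t0s)[t' t's Dt'] _.
have Ct' : C t'.
  have Cz : C (c * t0 * (t'^-1 * (c * t0))^-1).
    by apply: (CM); [exact: CM | apply/CV; case: Dt'].
  by move: Cz; rewrite invgM invgK mulgA mulgV mul1g.
have zs z : z \in s -> C z -> D z by move=> sz; apply: YD; rewrite mem_cat sz.
have := DM _ _ (DM _ _ (zs _ t's Ct') Dt') (DV _ (zs _ t0s Ct0)).
by rewrite mulgA mulgV mul1g mulgK => -[].
Qed.

Definition finite_or_indicable_mod A B :=
  finite_index_in A B \/ virtually_indicable_mod A B.

(** The step common to extensions and to splitting off a generator: an infinite
    quotient B/C already provides a homomorphism, and otherwise the problem is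
    moved to C/A. *)
Lemma finite_or_indicable_extension A C B :
  subgroup B -> A `<=` C -> C `<=` B ->
  finite_or_indicable_mod C B ->
  (finite_index_in C B -> finite_or_indicable_mod A C) ->
  finite_or_indicable_mod A B.
Proof.
move=> sB AC CB [iC|vC] h; last first.
  by right; exact: virtually_indicable_quotient AC vC.
case: (h iC) => [iA|vA]; first by left; exact: finite_index_in_trans iA iC.
by right; exact: virtually_indicable_overgroup vA.
Qed.

(** Either a positive power of x lies in A, and the smaller powers represent all
    cosets, or the exponent of x modulo A is a well-defined homomorphism. *)
Lemma finite_or_indicable_cyclic A C x :
  subgroup C -> normal_in A C -> C x ->
  (forall y, C y -> exists k, A ((expgz x k)^-1 * y)) ->
  finite_or_indicable_mod A C.
Proof.
move=> sC nA Cx cyc; have [C1 CM CV] := sC; have [[A1 AM AV] AC _] := nA.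
have Cz k : C (expgz x k).
  have Cn n : C (x ^+ n).
    by elim: n => [|n IH]; [rewrite expg0 | rewrite expgS; exact: CM].
  by case: k => n; [exact: Cn | exact/CV/Cn].
have [[n An]|noA] := pselect (exists n, A (x ^+ n.+1)).
- left; exists [seq x ^+ i | i <- iota 0 n.+1].
    by move=> _ /mapP[i _ ->]; exact: (Cz (Posz i)).
  move=> y Cy; have [k Ak] := cyc y Cy.
  pose r := (k %% n.+1%:Z)%Z; pose q := (k %/ n.+1%:Z)%Z.
  have Aq m : A (expgz x (m * n.+1%:Z)%R).
    have Aqn i : A (expgz x (Posz i * n.+1%:Z)%R).
      elim: i => [|i IH]; first by rewrite mul0r.
      by rewrite -addn1 PoszD mulrDl mul1r expgzD; exact: AM.
    case: m => i; first exact: Aqn.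
    by rewrite NegzE mulNr expgzN; exact/AV/Aqn.
  have rE : r = Posz `|r|%N by rewrite gez0_abs // modz_ge0.
  exists (x ^+ `|r|%N).
    apply/mapP; exists `|r|%N => //.
    by rewrite mem_iota /= add0n -ltz_nat -rE ltz_pmod.
  have -> : x ^+ `|r|%N = expgz x r by rewrite [in RHS]rE.
  have := AM _ _ (Aq q) Ak; rewrite [in X in A X -> _](divz_eq k n.+1%:Z) -/q -/r.
  by rewrite addrC expgzD invgM !mulgA mulgV mul1g.
- right; have noAz k : A (expgz x k) -> k = 0%R.
    case: k => [[|n]|n] //= Ax; first by case: noA; exists n.
    by case: noA; exists n; move/AV: Ax; rewrite invgK.
  have ex y : exists k, C y -> A ((expgz x k)^-1 * y).
    by have [/cyc[k ?]|nC] := pselect (C y); [exists k | exists 0%R].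
  have /choice[phi phiP] := ex.
  have phiU y k : C y -> A ((expgz x k)^-1 * y) -> phi y = k.
    move=> Cy Ak; apply/eqP; rewrite -subr_eq0; apply/eqP/noAz.
    have := AM _ _ Ak (AV _ (phiP _ Cy)).
    by rewrite invgM invgK mulgA mulgK -expgzN -expgzD addrC.
  exists C, phi; split.
  - by split.
  - exists [:: 1]; first by move=> t; rewrite /= inE => /eqP ->.
    by move=> y Cy; exists 1; rewrite ?mem_head // invg1 mul1g.
  - move=> y z Cy Cz'; apply: phiU; first exact: CM.
    rewrite expgzD invgM.
    have := AM _ _ (normal_inV sC nA (Cz (phi z)) (phiP _ Cy)) (phiP _ Cz').
    by rewrite !mulgA mulgK.
  - by move=> a Aa Ca; apply: phiU; rewrite //= expg0 invg1 mul1g.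
  - exists x => //; rewrite (phiU x 1%R) //=.
    by rewrite expg1 mulVg.
Qed.

(** Induction on the number of generators, with A enlarged by the first
    generator x: modulo A, the new subgroup C is cyclic. *)
Lemma finite_or_indicable_abelian X A B :
  subgroup B -> normal_in A B ->
  (forall x y, B x -> B y -> A (x^-1 * y^-1 * x * y)) ->
  [set` X] `<=` B -> generated_mod A X B -> finite_or_indicable_mod A B.
Proof.
elim: X A => [|x X IH] A sB nA comm XB gX.
  have BA : B `<=` A by apply: gX => //; case: nA.
  left; exists [:: 1]; first by case: sB => ? ? ? t; rewrite /= inE => /eqP ->.
  by move=> y /BA Ay; exists 1; rewrite ?mem_head // invg1 mul1g.
have [B1 BM BV] := sB; have [[A1 AM AV] AB nAB] := nA.
have Bx : B x by apply: XB; rewrite /= mem_head.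
pose C := [set y | exists k, A ((expgz x k)^-1 * y)].
have Bz k : B (expgz x k).
  have Bn n : B (x ^+ n).
    by elim: n => [|n IHn]; [rewrite expg0 | rewrite expgS; exact: BM].
  by case: k => n; [exact: Bn | exact/BV/Bn].
have AC : A `<=` C by move=> a Aa; exists 0%R; rewrite /= expg0 invg1 mul1g.
have CB : C `<=` B.
  by move=> y [k /AB By]; rewrite -[y](mulVKg (expgz x k)); exact: BM.
have sC : subgroup C.
  split; first exact: AC.
  - move=> y z [k Ay] [l Az]; exists (k + l)%R.
    rewrite expgzD invgM.
    have := AM _ _ (normal_inV sB nA (Bz l) Ay) Az.
    by rewrite !mulgA mulgK.
  - move=> y [k Ay]; exists (- k)%R; rewrite expgzN invgK.
    have := nAB _ _ (Bz k) (AV _ Ay).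
    by rewrite invgM invgK mulgA mulgK.
have nC : normal_in C B.
  split=> // b y Bb [k Ay]; exists k.
  have := AM _ _ (comm _ _ (Bz k) (BV _ Bb)) (nAB _ _ Bb Ay).
  by rewrite invgK !mulgA mulgVK mulgK.
apply: (finite_or_indicable_extension sB AC CB).
  apply: IH => //.
  - by move=> y z By Bz'; apply/AC/comm.
  - by move=> y Xy; apply: XB; rewrite /= inE Xy orbT.
  - move=> D sD CD XD; apply: gX => //; first by move=> a /AC/CD.
    move=> y; rewrite /= inE => /orP[/eqP ->|/XD //].
    by apply: CD; exists 1%R; rewrite /= expg1 mulVg.
move=> _; apply: (finite_or_indicable_cyclic (x := x)) => //.
- by split=> // b a /CB; exact: nAB.
- by exists 1%R; rewrite /= expg1 mulVg.
Qed.

End Virtual.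

(** * Sections of elementary amenable groups *)

(** Multiplicative maps are only required to preserve products; between groups
    they also preserve the unit and inverses. *)
Lemma hom1 (G H : groupType) (f : {multiplicative G -> H}) : f 1 = 1.
Proof. by apply: (mulIg (f 1)); rewrite -gmulfM !mul1g. Qed.

Lemma homV (G H : groupType) (f : {multiplicative G -> H}) x :
  f x^-1 = (f x)^-1.
Proof. by apply/esym/mulg1_eq; rewrite -gmulfM mulgV hom1. Qed.

(** The graph of a surjective homomorphism from a subgroup of K onto B/A, as a
    relation between K and B: k is related to every element of its image coset.
    Relations compose with homomorphisms in both directions, so neither
    subgroups of K nor quotients of B have to be formed as types. *)
Definition section_map (K G : groupType) (rho : K -> G -> Prop) (A B : set G) :=
  [/\ rho 1 1, forall k l y z, rho k y -> rho l z -> rho (k * l) (y * z),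
      forall k y, rho k y -> rho k^-1 y^-1,
      forall y, A y <-> rho 1 y & forall y, B y <-> exists k, rho k y].

Lemma section_map_normal (K G : groupType) rho (A B : set G) :
  @section_map K G rho A B -> subgroup B /\ normal_in A B.
Proof.
move=> [r1 rM rV rA rB].
have sB : subgroup B.
  split; first by apply/rB; exists 1.
  - by move=> x y /rB[k rx] /rB[l ry]; apply/rB; exists (k * l); exact: rM.
  - by move=> x /rB[k rx]; apply/rB; exists k^-1; exact: rV.
split=> //; split.
- split; first exact/rA.
  + by move=> x y /rA rx /rA ry; apply/rA; rewrite -[1]mulg1; exact: rM.
  + by move=> x /rA rx; apply/rA; rewrite -invg1; exact: rV.
- by move=> x /rA rx; apply/rB; exists 1.
- move=> b a /rB[k rb] /rA ra; apply/rA; rewrite -(mulgV k) -{1}[k]mulg1.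
  by apply: (rM); [exact: rM | exact: rV].
Qed.

(** The target group G is kept fixed, while K runs over the elementary amenable
    groups. *)
Lemma elementary_amenable_sections K (G : groupType) :
  elementary_amenable K -> forall rho (A B : set G) X,
  @section_map K G rho A B -> [set` X] `<=` B -> generated_mod A X B ->
  finite_or_indicable_mod A B.
Proof.
elim=> {K}.
- move=> K /finite_seqP[e eE] rho A B X sec XB gX; left.
  have [r1 rM rV rA rB] := sec.
  have Ae k : k \in e by have : [set: K] k by []; rewrite eE.
  pose e1 : seq_sub e := SeqSub (Ae 1).
  have /choice[c cP] : forall y, exists k : seq_sub e, B y -> rho (val k) y.
    move=> y; have [/rB[k rk]|nB] := pselect (B y); last by exists e1.
    by exists (SeqSub (Ae k)).
  apply: (@finite_index_in_classes _ _ c) => x y /cP rx /cP ry cxy.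
  by apply/rA; rewrite -(mulVg (val (c y))) -{1}cxy; apply: (rM) => //; exact: rV.
- move=> K cK rho A B X sec XB gX.
  have [sB nA] := section_map_normal sec; have [r1 rM rV rA rB] := sec.
  apply: (finite_or_indicable_abelian sB nA _ XB gX).
  move=> x y /rB[k rx] /rB[l ry]; apply/rA.
  have -> : 1 = k^-1 * l^-1 * k * l.
    by rewrite -[k^-1 * l^-1 * k]mulgA (cK l^-1) !mulgA mulVg mul1g mulVg.
  by do 3?apply: (rM) => //; exact: rV.
- move=> K H f f_inj _ IH rho A B X [r1 rM rV rA rB] XB gX.
  apply: (IH (fun k y => exists2 h, f h = k & rho h y) A B X) => //; split.
  + by exists 1; rewrite ?hom1.
  + by move=> _ _ y z [h <- hy] [h' <- hz]; exists (h * h'); rewrite ?gmulfM //; exact: rM.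
  + by move=> _ y [h <- hy]; exists h^-1; rewrite ?homV //; exact: rV.
  + move=> y; split=> [/rA r|[h]]; first by exists 1; rewrite ?hom1.
    by rewrite -(hom1 f) => /f_inj -> r; apply/rA.
  + move=> y; split=> [/rB[h r]|[_ [h _ r]]]; first by exists (f h), h.
    by apply/rB; exists h.
- move=> K H f f_surj _ IH rho A B X [r1 rM rV rA rB] XB gX.
  have fS h : exists k, f k = h.
    by have : [set: H] h by []; rewrite -f_surj => -[k _ <-]; exists k.
  apply: (IH (fun k y => rho (f k) y) A B X) => //; split.
  + by rewrite hom1.
  + by move=> k l y z ? ?; rewrite gmulfM; exact: rM.
  + by move=> k y ?; rewrite homV; exact: rV.
  + by move=> y; rewrite hom1.
  + move=> y; split=> [/rB[h r]|[k r]]; last by apply/rB; exists (f k).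
    by have [k fk] := fS h; exists k; rewrite fk.
- move=> N K Q f p f_inj p_surj exact_fp _ IHN _ IHQ rho A B X sec XB gX.
  have [sB nA] := section_map_normal sec; have [r1 rM rV rA rB] := sec.
  (* The part of B that comes from the kernel. *)
  pose C := [set y | exists n, rho (f n) y].
  have AC : A `<=` C by move=> y /rA r; exists 1; rewrite hom1.
  have CB : C `<=` B by move=> y [n r]; apply/rB; exists (f n).
  have secQ : section_map (fun q y => exists2 k, p k = q & rho k y) C B.
    split.
    + by exists 1; rewrite ?hom1.
    + by move=> _ _ y z [h <- hy] [h' <- hz]; exists (h * h'); rewrite ?gmulfM //; exact: rM.
    + by move=> _ y [h <- hy]; exists h^-1; rewrite ?homV //; exact: rV.
    + move=> y; split=> [[n r]|[k pk r]].
        exists (f n) => //.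
        by have : range f (f n) by [exists n]; rewrite exact_fp.
      have : (p @^-1` [set 1]) k by [].
      by rewrite -exact_fp => -[n _ fn]; exists n; rewrite fn.
    + move=> y; split=> [/rB[k r]|[_ [k _ r]]]; first by exists (p k), k.
      by apply/rB; exists k.
  have secN : section_map (fun n y => rho (f n) y) A C.
    split.
    + by rewrite hom1.
    + by move=> k l y z ? ?; rewrite gmulfM; exact: rM.
    + by move=> k y ?; rewrite homV; exact: rV.
    + by move=> y; rewrite hom1.
    + by [].
  have gC : generated_mod C X B.
    by move=> D sD CD; apply: gX => // a /AC/CD.
  apply: (finite_or_indicable_extension sB AC CB (IHQ _ _ _ _ secQ XB gC)).
  move=> iC; have [sC _] := section_map_normal secN.
  have [Y YC gY] := schreier sB sC nA AC CB iC XB gX.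
  exact: IHN secN YC gY.
- move=> K I Ki f f_inj f_dir f_cov _ IH rho A B X sec XB gX.
  have [sB nA] := section_map_normal sec; have [r1 rM rV rA rB] := sec.
  (* Finitely many generators lift to a single term of the union. *)
  have [i iX] : exists i, forall x, x \in X -> exists k, rho (f i k) x.
    elim: X {gX} XB => [|x X IHX] XB.
      by have [i _] := f_cov 1; exists i.
    have [i iX] := IHX (fun y Xy => XB y (mem_behead (s := x :: X) Xy)).
    have /rB[k rk] : B x by apply: XB; rewrite /= mem_head.
    have [j [l _ ljk]] := f_cov k; have [m [im jm]] := f_dir i j.
    have lift n u : range (f n) `<=` range (f m) -> exists v, f m v = f n u.
      by move=> /(_ (f n u)) [|v _ fv]; [exists u | exists v].
    exists m => y; rewrite inE => /orP[/eqP ->|/iX[u ru]].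
      by have [v fv] := lift j l jm; exists v; rewrite fv ljk.
    by have [v fv] := lift i u im; exists v; rewrite fv.
  apply: (IH i (fun k y => rho (f i k) y) A B X) => //; split.
  + by rewrite hom1.
  + by move=> k l y z ? ?; rewrite gmulfM; exact: rM.
  + by move=> k y ?; rewrite homV; exact: rV.
  + by move=> y; rewrite hom1.
  + move=> y; split=> [|[k r]]; last by apply/rB; exists (f i k).
    apply: (gX [set y | exists k, rho (f i k) y]).
    * split; first by exists 1; rewrite hom1.
        by move=> u v [k rk] [l rl]; exists (k * l); rewrite gmulfM; exact: rM.
      by move=> u [k rk]; exists k^-1; rewrite homV; exact: rV.
    * by move=> a /rA r; exists 1; rewrite hom1.
    * exact: iX.
Qed.

(** * Passing to a normal subgroup *)

Section Core.
Variable G : groupType.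
Implicit Types (A B C D N : set G) (x y : G) (phi : G -> int).

Lemma additive_on1 D phi : subgroup D -> additive_on D phi -> phi 1 = 0%R.
Proof.
move=> [D1 _ _] aD; apply: (addrI (phi 1)).
by rewrite -aD // mulg1 addr0.
Qed.

Lemma additive_onV D phi x : subgroup D -> additive_on D phi -> D x ->
  phi x^-1 = (- phi x)%R.
Proof.
move=> sD aD Dx; have [_ _ DV] := sD; apply: (addrI (phi x)).
by rewrite -aD ?mulgV ?subrr ?(additive_on1 sD) //; exact: DV.
Qed.

Lemma additive_onX D phi x n : subgroup D -> additive_on D phi -> D x ->
  D (x ^+ n) /\ phi (x ^+ n) = (phi x *+ n)%R.
Proof.
move=> sD aD Dx; have [D1 DM _] := sD; elim: n => [|n [IHD IH]].
  by rewrite expg0 mulr0n (additive_on1 sD).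
by rewrite expgS aD // IH mulrS; split=> //; exact: DM.
Qed.

Definition normal_core D := [set g | forall x, D (x^-1 * g * x)].

Lemma normal_core_normal D : subgroup D -> normal_subgroup (normal_core D).
Proof.
move=> [D1 DM DV]; split; first split.
- by move=> x; rewrite mulg1 mulVg.
- move=> g h Ng Nh x; have := DM _ _ (Ng x) (Nh x).
  by rewrite !mulgA mulgK.
- by move=> g Ng x; have := DV _ (Ng x); rewrite !invgM invgK mulgA.
- move=> g y Ny x; have := Ny (g^-1 * x).
  by rewrite invgM invgK !mulgA.
Qed.

Lemma normal_core_sub D : normal_core D `<=` D.
Proof. by move=> g /(_ 1); rewrite invg1 mul1g mulg1. Qed.

(** The core is the kernel of the action on the finite set of cosets of D. *)
Lemma normal_core_finite_index D : subgroup D ->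
  finite_index_in D setT -> finite_index_in (normal_core D) setT.
Proof.
move=> [D1 DM DV] [s _ sD].
have /choice[c cP] : forall x, exists t : seq_sub s, D ((val t)^-1 * x).
  by move=> x; have [t ts Dt] := sD x I; exists (SeqSub ts).
pose p g := [ffun t : seq_sub s => c (g * val t)].
apply: (@finite_index_in_classes _ _ p) => g h _ _ pgh x.
pose t := c x; set d := (val t)^-1 * x; have Dd : D d := cP x.
have cE : c (g * val t) = c (h * val t).
  by move/ffunP/(_ t): pgh; rewrite !ffunE.
have := DM _ _ (DV _ (cP (g * val t))) (cP (h * val t)).
rewrite cE invgM invgK !invgM !mulgA mulgK => Dgh.
have := DM _ _ (DM _ _ (DV _ Dd) Dgh) Dd.
by rewrite /d !invgM invgK !mulgA !mulgK.
Qed.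

(** If phi vanished on N, it would take finitely many values on D, whereas the
    powers of x have infinitely many distinct values. *)
Lemma additive_on_finite_index_nonzero D N phi x :
  subgroup D -> additive_on D phi -> subgroup N -> N `<=` D ->
  finite_index_in N setT -> D x -> phi x <> 0%R ->
  exists2 y, N y & phi y <> 0%R.
Proof.
move=> sD aD sN ND [s _ sN'] Dx nx; apply: contrapT => no.
have zN y : N y -> phi y = 0%R.
  by move=> Ny; apply: contrapT => ny; apply: no; exists y.
have [D1 DM DV] := sD.
pose v := [seq phi (x ^+ i) | i <- iota 0 (size s).+1].
have uv : uniq v.
  rewrite map_inj_uniq ?iota_uniq // => i j.
  have [_ ->] := additive_onX i sD aD Dx; have [_ ->] := additive_onX j sD aD Dx.
  move=> /eqP; rewrite -(mulr_natr _ i) -(mulr_natr _ j) -subr_eq0 -mulrBr mulf_eq0.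
  case/orP=> [/eqP //|]; rewrite subr_eq0 !natz => /eqP.
  by case.
have : (size v <= size [seq phi t | t <- s])%N.
  apply: uniq_leq_size => // _ /mapP[i _ ->].
  have [Dxi _] := additive_onX i sD aD Dx.
  have [t ts Nt] := sN' (x ^+ i) I.
  apply/mapP; exists t => //.
  have Dt : D t.
    by have := DM _ _ Dxi (DV _ (ND _ Nt)); rewrite invgM invgK mulgA mulgV mul1g.
  by rewrite -[x ^+ i in LHS](mulVKg t) aD ?(zN _ Nt) ?addr0 //; exact: ND.
by rewrite /v !size_map size_iota ltnn.
Qed.

(** Representatives without repetition, so that the indices of type ['I_n] are
    the vertices of the quotient graph.  Here the cosets are the right cosets,
    that is, the orbits of N under left translation. *)
Lemma transversal_exists N : normal_subgroup N -> finite_index_in N setT ->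
  exists n (t : 'I_n -> G) (r : G -> 'I_n),
    [/\ cancel t r, forall g x, N g -> r (g * x) = r x
      & forall x, N (x * (t (r x))^-1)].
Proof.
move=> [[N1 NM NV] nN] [s _ sN].
(* Choosing from the coset as a set makes [rep] constant on cosets. *)
pose coset x := [set y | N (y * x^-1)].
pose rep x := xget 1 (coset x).
have repN x : N (rep x * x^-1).
  by rewrite /rep; case: xgetP => [y _ //|/(_ x)]; case; rewrite /coset /= mulgV.
have rep_eq g x y : N g -> y = g * x -> rep y = rep x.
  move=> Ng ->; congr (xget 1 _); apply/seteqP; split=> z; rewrite /coset /= => Nz.
    by have := NM _ _ Nz Ng; rewrite invgM !mulgA mulgVK.
  by have := NM _ _ Nz (NV _ Ng); rewrite invgM !mulgA.
have repK x : rep (rep x) = rep x by apply: rep_eq (repN x) _; rewrite mulgVK.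
pose T := undup [seq rep x | x <- s].
have repT x : rep x \in T.
  rewrite mem_undup; have [u us Nu] := sN x I; apply/mapP; exists u => //.
  apply: (rep_eq (u * (u^-1 * x) * u^-1)); first exact: nN.
  by rewrite mulVKg mulgVK.
have rT x : (index (rep x) T < size T)%N by rewrite index_mem.
exists (size T), (fun i => nth 1 T i), (fun x => Ordinal (rT x)); split.
- move=> i; apply/val_inj => /=.
  have : nth 1 T i \in T by exact: mem_nth.
  rewrite {1}mem_undup => /mapP[x _ E].
  by rewrite E repK -E index_uniq ?undup_uniq.
- by move=> g x Ng; apply/val_inj; rewrite /= (rep_eq g x).
- by move=> x; rewrite /= nth_index //; have := NV _ (repN x); rewrite invgM invgK.
Qed.

End Core.

Local Close Scope group_scope.

(** * The Laplacian of a finite connected graph *)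

(** The graph has vertices ['I_n] and an edge from j to [sigma s j] for every
    label s in l; reversing edges is the involution [inv] on labels. *)
Section Laplacian.
Variables (I : eqType) (l : seq I) (inv : I -> I) (n : nat)
  (sigma : I -> 'I_n -> 'I_n).
Hypothesis invK : involutive inv.
Hypothesis l_sym : perm_eq [seq inv s | s <- l] l.
Hypothesis sigmaK : forall s, cancel (sigma s) (sigma (inv s)).
Hypothesis connected : forall P : pred 'I_n,
  (forall s j, s \in l -> P j -> P (sigma s j)) -> forall i j, P i -> P j.

(** The maximum principle: the set where c is maximal is closed under passing to
    neighbours. *)
Lemma harmonic_constant (c : 'I_n -> rat) :
  (forall j, \sum_(s <- l) (c (sigma s j) - c j) = 0) ->
  forall i j, c i = c j.
Proof.
move=> hc i0 j0; pose m := [arg max_(i > i0) c i]%O.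
have cm j : c j <= c m by rewrite /m; case: arg_maxP => // k _; exact.
suff cE j : c j == c m by rewrite (eqP (cE i0)) (eqP (cE j0)).
apply: (@connected (fun j => c j == c m) _ m) => // s k sl /eqP ck.
have := hc k; move/eqP; rewrite -oppr_eq0 -sumrN psumr_eq0; last first.
  by move=> u _; rewrite opprB ck subr_ge0.
by move=> /allP/(_ s sl) /=; rewrite oppr_eq0 subr_eq0 ck.
Qed.

(** The columns of the cokernel of the matrix M of the Laplacian are harmonic,
    hence constant, so b annihilates them and lies in the row space of M. *)
Lemma laplacian_solvable_rat (b : 'I_n -> rat) : \sum_j b j = 0 ->
  exists a : 'I_n -> rat,
    forall j, \sum_(s <- l) (a (sigma s j) - a j) = b j.
Proof.
move=> b0.
pose M : 'M[rat]_n :=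
  \matrix_(i, j) \sum_(s <- l) ((i == sigma s j)%:R - (i == j)%:R).
pose v : 'rV[rat]_n := \row_j b j.
have sigmaKV s : cancel (sigma (inv s)) (sigma s).
  by move=> j; rewrite -{1}[s]invK sigmaK.
have pick (c : 'I_n -> rat) k : \sum_j (j == k)%:R * c j = c k.
  rewrite (bigD1 k) //= eqxx mul1r big1 ?addr0 // => j /negPf ->.
  by rewrite mul0r.
have : (v <= M)%MS.
  rewrite submxE; apply/eqP/matrixP => i0 k; rewrite !mxE.
  pose c j := cokermx M j k.
  have cc : forall i j, c i = c j.
    apply: harmonic_constant => i.
    have : (M *m cokermx M) i k = 0 by rewrite mulmx_coker mxE.
    rewrite mxE => Mc; rewrite -[RHS]Mc -(perm_big _ l_sym) big_map.
    under [RHS]eq_bigr do rewrite mxE mulr_suml.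
    rewrite [RHS]exchange_big; apply: eq_bigr => s _ /=.
    under eq_bigr do rewrite mulrBl.
    rewrite big_split /= sumrN; congr (_ - _).
      rewrite -[LHS](pick c (sigma (inv s) i)); apply: eq_bigr => j _.
      congr (_%:R * _); congr nat_of_bool.
      by rewrite [RHS]eq_sym (can2_eq (@sigmaK s) (@sigmaKV s)).
    by rewrite -[LHS](pick c i); apply: eq_bigr => j _; rewrite eq_sym.
  case: (pickP (xpredT : pred 'I_n)) => [j0 _|none].
    transitivity ((\sum_j b j) * c j0); last by rewrite b0 mul0r.
    by rewrite mulr_suml; apply: eq_bigr => j _; rewrite mxE -(cc j j0).
  by apply: big1 => j; have := none j.
move=> /submxP[a vE].
exists (fun i => a 0 i) => j.
have : v 0 j = (a *m M) 0 j by rewrite -vE.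
rewrite !mxE => ->.
under [RHS]eq_bigr do rewrite mxE mulr_sumr.
rewrite exchange_big; apply: eq_bigr => s _ /=.
under eq_bigr do rewrite mulrC mulrBl.
by rewrite big_split /= sumrN !pick.
Qed.

(** The factor k is a common denominator of a rational solution. *)
Lemma laplacian_solvable (b : 'I_n -> int) : \sum_j b j = 0 ->
  exists (k : int) (a : 'I_n -> int), k != 0 /\
    forall j, \sum_(s <- l) (a (sigma s j) - a j) = k * b j.
Proof.
move=> b0.
have /laplacian_solvable_rat[a aE] : \sum_j (b j)%:~R = 0 :> rat.
  by rewrite -rmorph_sum b0.
pose k := \prod_i denq (a i).
have aZ i : exists z : int, z%:~R = k%:~R * a i.
  exists (numq (a i) * \prod_(j | j != i) denq (a j)).
  rewrite /k [in RHS](bigD1 i) //= !intrM mulrAC.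
  by rewrite numqE [a i * _]mulrC.
have [z zE] := choice aZ.
exists k, z; split.
  by apply/prodf_neq0 => i _; exact: denq_neq0.
move=> j; apply: (@intr_inj rat).
rewrite rmorph_sum /= intrM -aE mulr_sumr.
by apply: eq_bigr => s _; rewrite intrB !zE mulrBr.
Qed.

End Laplacian.

Local Open Scope group_scope.

(** * Harmonic extension of a homomorphism to the integers *)

(** With [h x = k * phi (x * (t j)^-1) + a j] on the coset of [t j], being
    harmonic is a Laplace equation for a on the quotient graph.  The right-hand
    side has sum 0 because reversing an edge replaces its contribution
    [F s j] by the opposite. *)
Lemma harmonic_extension (G : groupType) (l : seq G) (N : set G)
    (phi : G -> int) :
  perm_eq [seq s^-1 | s <- l] l -> generates [set` l] ->
  normal_subgroup N -> finite_index_in N setT -> additive_on N phi ->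
  exists (k : int) (h : G -> int),
    [/\ k != 0%R, forall g x, N g -> h (g * x) = (k * phi g + h x)%R
      & forall x, (\sum_(s <- l) (h (x * s)%g - h x) = 0)%R].
Proof.
move=> l_sym gl nN iN aN; have [sN cN] := nN; have [N1 NM NV] := sN.
have [n [t [r [tK rN tN]]]] := transversal_exists nN iN.
pose sigma s j := r (t j * s).
have rM x y : r (t (r x) * y) = r (x * y).
  have := rN _ (t (r x) * y) (tN x).
  by rewrite mulgA mulgVK => ->.
have sigmaK s : cancel (sigma s) (sigma s^-1).
  by move=> j; rewrite /sigma rM mulgK tK.
pose F s j := phi (t j * s * (t (sigma s j))^-1).
have NF s j : N (t j * s * (t (sigma s j))^-1) by exact: tN.
have FV s j : F s^-1 (sigma s j) = (- F s j)%R.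
  rewrite /F sigmaK -(additive_onV sN aN) //; congr phi.
  by rewrite !invgM invgK mulgA.
have sumF : (\sum_j - (\sum_(s <- l) F s j) = 0)%R.
  rewrite sumrN; apply/eqP; rewrite oppr_eq0 exchange_big /=; apply/eqP.
  set S := (X in X = 0%R); have SN : S = (- S)%R.
    rewrite {1}/S -(perm_big _ l_sym) big_map -sumrN; apply: eq_bigr => s _.
    have bs : bijective (sigma s).
      exists (sigma s^-1); first exact: sigmaK.
      by move=> j; rewrite -{1}[s]invgK sigmaK.
    rewrite (reindex (sigma s)) /=; last exact: onW_bij.
    by rewrite -sumrN; apply: eq_bigr => j _.
  have : (S + S = 0)%R by rewrite {1}SN addNr.
  by move/eqP; rewrite -mulr2n mulrn_eq0 /= => /eqP.
have conn (P : pred 'I_n) : (forall s j, s \in l -> P j -> P (sigma s j)) ->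
    forall i j, P i -> P j.
  move=> Pl.
  (* An equivalence, unlike an implication, is stable under inverses. *)
  pose E := [set g | forall j, P j = P (sigma g j)].
  have sE : subgroup E.
    split.
    - by move=> j; rewrite /sigma mulg1 tK.
    - move=> g h Eg Eh j; rewrite (Eg j) (Eh (sigma g j)).
      by rewrite /sigma rM mulgA.
    - move=> g Eg j; rewrite (Eg (sigma g^-1 j)).
      by rewrite -{1}[g]invgK sigmaK.
  have ET : E = setT.
    apply: gl => // s /= sl j; apply/idP/idP; first exact: Pl.
    have sVl : s^-1 \in l by rewrite -(perm_mem l_sym) map_f.
    by move=> /(Pl _ _ sVl); rewrite sigmaK.
  move=> i j Pi; have Eij : E ((t i)^-1 * t j) by rewrite ET.
  by move: Pi; rewrite (Eij i) /sigma mulVKg tK.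
have [k [a [k0 aE]]] := laplacian_solvable invgK l_sym sigmaK conn sumF.
pose h x := (k * phi (x * (t (r x))^-1)%g + a (r x))%R.
have hN g x : N g -> h (g * x) = (k * phi g + h x)%R.
  by move=> Ng; rewrite /h rN // -mulgA (aN g) ?mulrDr ?addrA.
exists k, h; split=> // x.
(* Increments are invariant under N: x may be moved to the transversal. *)
transitivity (\sum_(s <- l) (h (t (r x) * s)%g - h (t (r x))))%R.
  have hx y : h (x * y) = (k * phi (x * (t (r x))^-1)%g + h (t (r x) * y)%g)%R.
    by rewrite -hN // mulgA mulgVK.
  have hx1 : h x = (k * phi (x * (t (r x))^-1)%g + h (t (r x)))%R.
    by rewrite -{1}[x]mulg1 hx mulg1.
  apply: eq_bigr => s _; rewrite hx hx1.
  by rewrite opprD addrACA subrr add0r.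
set j := r x.
have ht s : (h (t j * s)%g - h (t j) = k * F s j + (a (sigma s j) - a j))%R.
  by rewrite /h !tK mulgV (additive_on1 sN) // mulr0 add0r -addrA.
under eq_bigr do rewrite ht.
by rewrite big_split /= -mulr_sumr aE mulrN subrr.
Qed.

(** * A height function that is nowhere locally constant *)

Lemma int_poly_nonroot (ps : seq {poly int}) : all (fun p => p != 0%R) ps ->
  exists m : int, all (fun p => p.[m] != 0)%R ps.
Proof.
move=> ps0; pose q := (\prod_(p <- ps) p)%R.
have q0 : q != 0%R by rewrite prodf_seq_neq0.
have [m mq] : exists m : int, ~~ root q m.
  apply: contrapT => no.
  have := max_poly_roots (rs := [seq Posz i | i <- iota 0 (size q)]) q0.
  rewrite size_map size_iota ltnn => H; suff: false by []; apply: H.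
    apply/allP => m _; apply: contrapT => /negP nm.
    by apply: no; exists m.
  by rewrite map_inj_uniq ?iota_uniq // => i j [].
exists m; apply/allP => p pps; apply: contra mq => pm.
rewrite /root horner_prod prodf_seq_eq0; apply/hasP; by exists p.
Qed.

Lemma nonconstant_edge (G : groupType) (M : zmodType) (l : seq G)
    (h : G -> M) x y :
  generates [set` l] -> h x <> h y ->
  exists v s, s \in l /\ h (v * s) <> h v.
Proof.
move=> gl hxy; apply: contrapT => no; apply: hxy.
pose E := [set g | forall v, h (v * g) = h v].
have ET : E = setT.
  apply: gl; last first.
    by move=> s sl v; apply: contrapT => ne; apply: no; exists v, s.
  split; first by move=> v; rewrite mulg1.
  - by move=> g g' Eg Eg' v; rewrite mulgA Eg'.
  - by move=> g Eg v; rewrite -[in RHS](mulgVK g v) Eg.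
have Exy : E (x^-1 * y) by rewrite ET.
by rewrite -(Exy x) mulVKg.
Qed.

(** The function is [v |-> \sum_i m ^+ i * h (t i * v)], normalised to vanish
    at 1.  Its increment along s at v is the value at m of a polynomial that
    depends only on the coset of v, as N is normal, and that is nonzero, since
    some [t i * v] lies in the coset of a vertex v0 where h changes along s. *)
Lemma nowhere_locally_constant_height (G : groupType) (l : seq G) (N : set G)
    (phi : G -> int) x :
  perm_eq [seq s^-1 | s <- l] l -> generates [set` l] ->
  normal_subgroup N -> finite_index_in N setT -> additive_on N phi ->
  N x -> phi x <> 0%R ->
  exists (h : G -> int),
    [/\ h 1 = 0%R,
        forall g v w, N g -> (h v - h w = h (g * v)%g - h (g * w)%g)%R,
        forall v, (\sum_(s <- l) (h (v * s)%g - h v) = 0)%R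
      & exists2 s, s \in l & forall v, h (v * s) <> h v].
Proof.
move=> l_sym gl nN iN aN Nx phix; have [[N1 NM NV] cN] := nN.
have [k [h [k0 hN hh]]] := harmonic_extension l_sym gl nN iN aN.
have hx : h x <> h 1.
  rewrite -[x]mulg1 hN // => /eqP; rewrite -subr_eq0 addrK mulf_eq0 (negPf k0).
  by move/eqP.
have [v0 [s [sl hs]]] := nonconstant_edge gl hx.
have [n [t [r [tK rN tN]]]] := transversal_exists nN iN.
pose D i j := (h (t i * t j * s)%g - h (t i * t j)%g)%R.
have hD g y : N g -> (h (g * y * s)%g - h (g * y)%g = h (y * s)%g - h y)%R.
  by move=> Ng; rewrite -mulgA !(hN g) // opprD addrACA subrr add0r.
have rD i v : (h (t i * v * s)%g - h (t i * v)%g = D i (r v))%R.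
  have Ng : N (t i * (v * (t (r v))^-1) * (t i)^-1) by apply: cN.
  by rewrite /D -(hD _ (t i * t (r v)) Ng) !mulgA !mulgVK.
have Dnz j : exists i, D i j != 0%R.
  exists (r (v0 * (t j)^-1)); apply/negP => /eqP D0; apply: hs.
  apply/eqP; rewrite -subr_eq0; apply/eqP; rewrite -[RHS]D0.
  have Ng := tN (v0 * (t j)^-1); rewrite /D -(hD _ _ Ng).
  by rewrite !mulgA mulgVK mulgVK.
pose p j := (\poly_(i < n) if insub i is Some i' then D i' j else 0)%R.
have pD j (i : 'I_n) : ((p j)`_i = D i j)%R by rewrite coef_poly ltn_ord valK.
have [m /allP mP] : exists m : int,
    all (fun q => q.[m] != 0)%R [seq p j | j <- enum 'I_n].
  apply: int_poly_nonroot; apply/allP => _ /mapP[j _ ->].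
  have [i Dij] := Dnz j; apply: contra Dij => /eqP pj0.
  by rewrite -pD pj0 coef0.
pose H v := (\sum_(i < n) h (t i * v)%g * m ^+ i)%R.
have Hs v : (H (v * s)%g - H v = (p (r v)).[m])%R.
  rewrite (horner_coef_wide m (size_poly _ _)) -sumrB; apply: eq_bigr => i _.
  by rewrite pD -mulrBl mulgA rD.
exists (fun v => H v - H 1%g)%R; split.
- by rewrite subrr.
- move=> g v w Ng; rewrite !opprB !addrA !subrK -!sumrB.
  apply: eq_bigr => i _; rewrite -!mulrBl; congr (_ * _)%R.
  have gi y : t i * (g * y) = (t i * g * (t i)^-1) * (t i * y).
    by rewrite !mulgA mulgVK.
  rewrite !gi !(hN (t i * g * (t i)^-1)) //; try exact: cN.
  by rewrite opprD addrACA subrr add0r.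
- move=> v; under eq_bigr do rewrite opprB addrA subrK -sumrB.
  rewrite exchange_big /= big1 // => i _.
  under eq_bigr do rewrite -mulrBl mulgA.
  by rewrite -mulr_suml hh mul0r.
- exists s => // v /eqP; rewrite -subr_eq0 opprB addrA subrK Hs.
  by apply/negP/mP/map_f; rewrite mem_enum.
Qed.

(** * Strong height functions on Cayley graphs *)

(** The whole group is its own section, with A trivial. *)
Lemma elementary_amenable_virtually_indicable (G : groupType) :
  infinite_set [set: G] -> finitely_generated G -> elementary_amenable G ->
  exists (N : set G) (phi : G -> int),
    [/\ normal_subgroup N, finite_index_in N setT, additive_on N phi
      & exists2 x, N x & phi x <> 0%R].
Proof.
move=> infG [X0 [/finite_seqP[X ->] gX]] eaG.
have sec : section_map (fun k y : G => k = y) [set 1] setT.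
  split=> //.
  - by move=> k l y z -> ->.
  - by move=> k y ->.
  - by move=> y; split=> _ //; exists y.
have [[s _ s1]|[D [phi [[sD _] iD aD _ [x Dx nx]]]]] :
    finite_or_indicable_mod [set 1] [set: G].
  apply: (elementary_amenable_sections eaG sec (X := X)) => //.
  by move=> D sD _ XD; rewrite (gX D sD XD).
- case: infG; apply: (@sub_finite_set _ _ [set` s]); last exact: finite_seq.
  move=> x _; have [t ts /= /mulg1_eq] := s1 x I.
  by rewrite invgK => <-.
have nN := normal_core_normal sD; have iN := normal_core_finite_index sD iD.
have aN : additive_on (normal_core D) phi.
  by move=> y z /normal_core_sub Dy /normal_core_sub Dz; exact: aD.
exists (normal_core D), phi; split=> //.
by apply: (additive_on_finite_index_nonzero sD aD _ _ iN Dx nx);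
  [case: nN | exact: normal_core_sub].
Qed.

Lemma finite_index_in_setT (G : groupType) (N : set G) :
  subgroup N -> finite_index_in N setT -> finite_index N.
Proof.
move=> [N1 NM NV] [s _ sN].
pose f (g : G) := [set g * x | x in N].
apply: (@sub_finite_set _ _ (f @` [set` s])); last exact/finite_image/finite_seq.
move=> _ [g _ <-]; have [t ts Nt] := sN g I; exists t => //.
apply/seteqP; split=> _ [x Nx <-].
  exists ((t^-1 * g)^-1 * x); first by apply: (NM) => //; exact: NV.
  by rewrite invgM invgK mulgA mulgA mulgV mul1g.
exists ((t^-1 * g) * x); first exact: NM.
by rewrite mulgA mulVKg.
Qed.

Lemma left_translations_automorphism (G : groupType) (S N : set G) :
  subgroup N -> automorphism_subgroup (cayley_adj S) (left_translations N).
Proof.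
move=> [N1 NM NV]; split.
- move=> _ [g Ng <-]; split.
    by exists (fun v => g^-1 * v) => v; [exact: mulKg | exact: mulVKg].
  move=> u v; split=> -[s Ss E]; exists s => //.
    by apply: (mulgI g); rewrite mulgA.
  by rewrite E mulgA.
- by exists 1 => //; apply/funext => v; rewrite mul1g.
- move=> _ _ [g Ng <-] [g' Ng' <-]; exists (g * g'); first exact: NM.
  by apply/funext => v /=; rewrite mulgA.
- move=> _ b [g Ng <-] _ bK; exists g^-1; first exact: NV.
  by apply/funext => v; rewrite -[v in LHS]bK mulKg.
Qed.

(** The orbits are the right cosets, while [finite_index_in] is about left
    cosets; normality identifies the two. *)
Lemma left_translations_quasi_transitive (G : groupType) (N : set G) :
  normal_subgroup N -> finite_index_in N setT ->
  quasi_transitive (left_translations N).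
Proof.
move=> [[N1 NM NV] nN] [s _ sN].
pose f (v : G) := [set a v | a in left_translations N].
apply: (@sub_finite_set _ _ (f @` [set` s])); last exact/finite_image/finite_seq.
move=> _ [v _ <-]; have [t ts Nt] := sN v I; exists t => //.
have Nd : N (v * t^-1) by have := nN t _ Nt; rewrite mulVKg.
apply/seteqP; split=> _ [_ [g Ng <-] <-].
  exists (fun w => (g * (v * t^-1)^-1) * w).
    by exists (g * (v * t^-1)^-1) => //; apply: (NM) => //; exact: NV.
  by rewrite invgM invgK !mulgA !mulgVK.
exists (fun w => (g * (v * t^-1)) * w); last by rewrite !mulgA mulgVK.
by exists (g * (v * t^-1)) => //; exact: NM.
Qed.

Lemma neighbours_cayley (G : groupType) (S : set G) (v : G) :
  neighbours (cayley_adj S) v = [set v * s | s in S].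
Proof. by apply/seteqP; split=> [u [s Ss ->]|_ [s Ss <-]]; exists s. Qed.

Lemma harmonic_cayley (R : realType) (G : groupType) (S : set G) (l : seq G)
    (h : G -> int) :
  uniq l -> S = [set` l] -> l != [::] ->
  (forall v, \sum_(s <- l) (h (v * s)%g - h v) = 0)%R ->
  harmonic (cayley_adj S) (fun v => (h v)%:~R : R).
Proof.
move=> ul Sl l0 hh v.
have finS : finite_set S by rewrite Sl; exact: finite_seq.
have nE : neighbours (cayley_adj S) v = [set` [seq v * s | s <- l]].
  rewrite neighbours_cayley Sl; apply/seteqP; split=> u.
    by move=> [s sl <-]; exact: map_f.
  by move=> /mapP[s sl ->]; exists s.
have uvl : uniq [seq v * s | s <- l] by rewrite map_inj_uniq //; exact: mulgI.
have pl : perm_eq (fset_set [set` [seq v * s | s <- l]]) [seq v * s | s <- l].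
  apply: uniq_perm; [exact: fset_uniq | exact: uvl |].
  by move=> u; rewrite in_fset_set ?mem_setE //; exact: finite_seq.
rewrite nE fsbig_finite /=; last exact: finite_seq.
rewrite (perm_big _ pl) (perm_size pl) size_map big_map.
have := hh v; rewrite sumrB big_const_seq count_predT iter_addr_0 => /eqP.
rewrite subr_eq0 => /eqP hE.
have -> : (\sum_(s <- l) (h (v * s)%g)%:~R = (size l)%:R * (h v)%:~R :> R)%R.
  by rewrite -rmorph_sum hE /= rmorphMn /= mulr_natl.
by rewrite mulKf // pnatr_eq0 size_eq0.
Qed.

Lemma sum0_exists_gt0 (R : realDomainType) (I : eqType) (l : seq I)
    (F : I -> R) s :
  (\sum_(i <- l) F i = 0)%R -> s \in l -> F s <> 0%R ->
  exists2 i, i \in l & (0 < F i)%R.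
Proof.
move=> F0 sl nFs; apply: contrapT => no; apply: nFs.
have F_le0 i : i \in l -> (F i <= 0)%R.
  by move=> il; rewrite leNgt; apply/negP => Fi; apply: no; exists i.
have : (\sum_(i <- l | i \in l) - F i == 0)%R by rewrite -big_seq sumrN F0 oppr0.
rewrite psumr_eq0; last by move=> i /F_le0; rewrite oppr_ge0.
by move=> /allP/(_ s sl); rewrite sl oppr_eq0 => /eqP.
Qed.

Lemma strong_harmonic_height_function (R : realType) (G : groupType)
    (S N : set G) (phi : G -> int) x :
  cayley_generating_set S ->
  normal_subgroup N -> finite_index_in N setT -> additive_on N phi ->
  N x -> phi x <> 0%R ->
  exists h : G -> int,
    strong_graph_height_function S h N /\
    harmonic (cayley_adj S) (fun v => (h v)%:~R : R).
Proof.
move=> [finS genS symS _] nN iN aN Nx nx.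
pose l : seq G := fset_set S.
have lS : S = [set` l] by rewrite -[LHS](fset_setK finS).
have l_sym : perm_eq [seq s^-1 | s <- l] l.
  apply: uniq_perm; rewrite ?map_inj_uniq ?fset_uniq //; first exact: invg_inj.
  move=> s; apply/mapP/idP => [[u ul ->]|sl].
    have : S u^-1 by rewrite -symS; exists u => //; rewrite lS.
    by rewrite lS.
  have : S s by rewrite lS.
  by rewrite -symS => -[u Su us]; exists u => //; move: Su; rewrite {1}lS.
have gl : generates [set` l] by rewrite -lS.
have [h [h1 hN hh [s sl hs]]] :=
  nowhere_locally_constant_height l_sym gl nN iN aN Nx nx.
have [sN _] := nN.
exists h; split; last first.
  apply: (@harmonic_cayley R _ S l h) => //; first exact: fset_uniq.
  by apply/eqP => l0; rewrite l0 in sl.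
split=> //; first exact: finite_index_in_setT.
split=> //.
- exact: left_translations_automorphism.
- exact: left_translations_quasi_transitive.
- by move=> v w _ [g Ng <-]; exact: hN.
move=> v; pose F u := (h (v * u)%g - h v)%R.
have Fs : F s <> 0%R by move/eqP; rewrite subr_eq0 => /eqP; exact: hs.
have [w wl Fw] := sum0_exists_gt0 (hh v) sl Fs.
have [u ul Fu] : exists2 u, u \in l & (0 < - F u)%R.
  apply: (@sum0_exists_gt0 _ _ l (fun u => - F u)%R s) => //.
    by rewrite sumrN hh oppr0.
  by move/eqP; rewrite oppr_eq0 => /eqP.
exists (v * u), (v * w); split.
- by exists u; rewrite // lS.
- by exists w; rewrite // lS.
- by rewrite -subr_lt0 -oppr_gt0 Fu -subr_gt0.
Qed.

Local Close Scope group_scope.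

Theorem theorem4p1 (R : realType) (Gamma : groupType)
    (Gamma_infinite : infinite_set [set: Gamma])
    (Gamma_fg : finitely_generated Gamma)
    (Gamma_EG : elementary_amenable Gamma)
    (S : set Gamma) (S_gen : cayley_generating_set S) :
  exists (h : Gamma -> int) (N : set Gamma),
    strong_graph_height_function S h N /\
    harmonic (cayley_adj S) (fun v => (h v)%:~R : R).
Proof.
have [N [phi [nN iN aN [x Nx nx]]]] :=
  elementary_amenable_virtually_indicable Gamma_infinite Gamma_fg Gamma_EG.
have [h hP] := strong_harmonic_height_function R S_gen nN iN aN Nx nx.
by exists h, N.
Qed.
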